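(* If $q$ is a power of a prime and $n = q^2 + q + 1$, then $$g(n) \geq n + \sqrt{n - 3/4} - 3/2.$$
   Context: Graphs are finite and simple. A graph has no repeated cycle length if no two distinct cycles (as subgraphs) in it have the same length. An $n$-vertex graph is Hamiltonian if it contains a cycle of length $n$. For a positive integer $n \ge 3$, $g(n)$ denotes the maximum number of edges in an $n$-vertex Hamiltonian graph with no repeated cycle length. *)

(* Defs.v *)
From HB Require Import structures.
From mathcomp Require Import all_boot all_order all_algebra.

Set Implicit Arguments.
Unset Strict Implicit.
Unset Printing Implicit Defensive.

(* A graph on the vertex set V is given by its edge set, a set of 2-element
   subsets of V. *)
Definition simple_graph (V : finType) (E : {set {set V}}) : bool :=
  [forall e in E, #|e| == 2].

Definition cycle_edges (V : finType) (c : seq V) : {set {set V}} :=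
  [set [set x; next c x] | x in c].

(* As a cycle has no isolated vertex, it is determined as a subgraph by its
   edge set C; the listing c of its vertices is unique only up to rotation and
   reversal, so distinct cycles are distinct values of C, not of c. *)
Definition cycle_of_length (V : finType) (E : {set {set V}}) (k : nat)
    (C : {set {set V}}) : bool :=
  [&& 2 < k, C \subset E
    & [exists c : k.-tuple V, uniq c && (C == cycle_edges c)]].

(* The bound on k makes this decidable and loses nothing:
   see no_repeated_cycle_lengthP. *)
Definition no_repeated_cycle_length (V : finType) (E : {set {set V}}) : bool :=
  [forall k : 'I_#|V|.+1, forall C1, forall C2,
    cycle_of_length E k C1 ==> cycle_of_length E k C2 ==> (C1 == C2)].

Definition hamiltonian (V : finType) (E : {set {set V}}) : bool :=
  [exists C, cycle_of_length E #|V| C].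

Definition g (n : nat) : nat :=
  \max_(E : {set {set 'I_n}} |
    [&& simple_graph E, hamiltonian E & no_repeated_cycle_length E]) #|E|.

Lemma no_repeated_cycle_lengthP (V : finType) (E : {set {set V}}) :
  reflect (forall k C1 C2, cycle_of_length E k C1 -> cycle_of_length E k C2 ->
             C1 = C2)
          (no_repeated_cycle_length E).
Proof.
apply: (iffP forallP) => [H k C1 C2 h1 h2|H k].
  have ltk : k < #|V|.+1.
    case/and3P: h1 => _ _ /existsP[c /andP[Uc _]].
    by rewrite ltnS -(size_tuple c) -(card_uniqP Uc) max_card.
  have /forallP/(_ C1)/forallP/(_ C2) := H (Ordinal ltk).
  by rewrite /= h1 h2 => /eqP.
apply/forallP => C1; apply/forallP => C2.
by apply/implyP => h1; apply/implyP => h2; apply/eqP; apply: H h1 h2.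
Qed.

(* Main.v *)
Require Import Defs.
From mathcomp Require Import all_boot all_order all_algebra.
From mathcomp Require Import cyclic finfield.
From mathcomp Require Import zify ring.
Import Order.TTheory GRing.Theory Num.Theory.
Local Open Scope ring_scope.

Set Implicit Arguments.
Unset Strict Implicit.
Unset Printing Implicit Defensive.

(** Since n - 3/4 = (q + 1/2)^2, the bound to prove is g(n) >= n + q - 1, so
    the Hamiltonian graph needs q - 1 chords besides its n-cycle.  All of them
    can be taken at one vertex: let the graph consist of the path 1, ..., n-1
    and of a hub 0 joined to a set A of path vertices that contains both ends.
    A cycle must pass through the hub, so it is made of two spokes 0-a and 0-b
    and of the part of the path between a and b; its length is b - a + 2
    ([fan_cycle_run]).  The cycle lengths are therefore distinct as soon as the
    differences b - a are, and q + 1 spokes give n - 2 + (q + 1) edges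
    ([card_fan]).

    The set A comes from Singer's perfect difference set: a set D of q + 1
    residues mod n whose pairwise sums, hence also differences, are distinct
    ([singer]).  Take a generator w of the multiplicative group of the field
    with q^3 elements, and let D be the set of the discrete logarithms mod n
    of 1 and of the w - a, for a in the subfield F_q.  As n = (q^3-1)/(q-1),
    equality mod n of two sums of logarithms means that the corresponding
    products are equal up to a factor in F_q; this is a polynomial relation of
    degree at most 2 between w and F_q, which must be trivial as w has degree
    3, and the factors are recovered by unique factorization
    ([linpolyM_eval_inj]).

    As the (q + 1)q = n - 1 differences of D are distinct, they are all the
    nonzero residues; in particular 2 is one of them, and a translate of D
    contains 1 and -1.  It cannot contain 0 since 1 + (-1) = 0 + 0, so it
    serves as A ([sidon_normalize]). *)

(** * Sidon sets *)

Definition sidon (V : zmodType) (D : {pred V}) : Prop :=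
  forall a b c d, a \in D -> b \in D -> c \in D -> d \in D ->
    a + b = c + d -> (a = c /\ b = d) \/ (a = d /\ b = c).

Lemma sidon_diff (V : zmodType) (D : {pred V}) a b c d :
    sidon D -> a \in D -> b \in D -> c \in D -> d \in D ->
  a - b = c - d -> a != b -> a = c /\ b = d.
Proof.
move=> sidD aD bD cD dD e ab.
have /(sidD a d c b aD dD cD bD)[[-> ->]//|[ab']] : a + d = c + b.
  by rewrite -[a](subrK b) e addrAC subrK.
by rewrite ab' eqxx in ab.
Qed.

(** The pairs of distinct elements of D have distinct nonzero differences, and
    there are at least as many of them as nonzero elements of V. *)
Lemma perfect_difference (V : finZmodType) (D : {set V}) (q : nat) (x : V) :
    sidon D -> (q < #|D|)%N -> (#|V| <= (q ^ 2 + q).+1)%N -> x != 0 ->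
  exists a b, [/\ a \in D, b \in D & a - b = x].
Proof.
move=> sidD cD cV x0.
pose U := setX D D :\: [set (a, a) | a in D].
pose f (u : V * V) := u.1 - u.2.
have UP u : u \in U -> [/\ u.1 \in D, u.2 \in D & u.1 != u.2].
  case: u => a b; rewrite !inE /= => /and3P[ab aD bD]; split=> //.
  by apply: contraNneq ab => <-; apply/imsetP; exists a.
have f_inj : {in U &, injective f}.
  move=> [a b] [c d] /UP[/= aD bD ab] /UP[/= cD' dD _] e.
  by have [-> ->] := sidon_diff sidD aD bD cD' dD e ab.
have fU : f @: U = [set~ 0].
  apply/eqP; rewrite eqEcard; apply/andP; split.
    apply/subsetP => _ /imsetP[u /UP[_ _ ab] ->].
    by rewrite !inE subr_eq0.
  rewrite card_in_imset // cardsC1 cardsD cardsX (setIidPr _) ?card_imset.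
  - rewrite -[X in (_ - X)%N]muln1 -mulnBr; have cD1 : (q <= #|D| - 1)%N by lia.
    apply: leq_trans (leq_mul cD cD1); rewrite mulSn mulnn addnC.
    by rewrite -subn1 leq_subLR add1n.
  - by move=> a b [].
  by apply/subsetP => _ /imsetP[a aD ->]; rewrite inE /= aD.
have : x \in f @: U by rewrite fU !inE.
by case/imsetP => u /UP[aD bD _] ->; exists u.1, u.2.
Qed.

(** Writing 2 as a difference a - b in D, the translate by 1 - a maps a to 1 and
    b to -1, which is [ord_max]; the relation 1 + (-1) = 0 + 0 excludes 0. *)
Lemma sidon_normalize m q (D : {set 'I_m.+1}) :
    sidon D -> (q < #|D|)%N -> m = (q ^ 2 + q)%N -> (1 < q)%N ->
  exists A : {set 'I_m.+1},
    [/\ sidon A, (q < #|A|)%N, 0 \notin A, inZp 1 \in A & ord_max \in A].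
Proof.
move=> sidD cD def_m q1; have m3 : (3 < m)%N by nia.
have [||a [b [aD bD dab]]] := @perfect_difference _ D q (inZp 2) sidD cD.
- by rewrite card_ord def_m.
- by rewrite -val_eqE /= modn_small //; lia.
pose t := inZp 1 - a; pose A := [set x + t | x in D].
have sidA : sidon A.
  move=> _ _ _ _ /imsetP[x xD ->] /imsetP[y yD ->] /imsetP[z zD ->] /imsetP[s sD ->].
  rewrite ![_ + t + (_ + t)]addrACA => /addIr /sidD[] // [-> ->]; by [left|right].
have A1 : inZp 1 \in A.
  by apply/imsetP; exists a => //; rewrite /t addrC subrK.
have Amax : ord_max \in A.
  apply/imsetP; exists b => //; apply: (addIr (inZp 2)).
  have -> : b + t + inZp 2 = inZp 1 by rewrite -dab addrC addrA subrK addrC subrK.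
  apply: val_inj; rewrite /= modnDmr (_ : m + 2 = m.+1 + 1)%N ?modnDl //.
  by rewrite addn2 addn1.
exists A; split=> //; first by rewrite card_imset //; apply: addIr.
apply/negP => A0.
have e : inZp 1 + ord_max = 0 + 0 :> 'I_m.+1.
  by apply: val_inj; rewrite /= modnDml add1n modnn mod0n.
have : inZp 1 = 0 :> 'I_m.+1 by have [[->]|[->]] := sidA _ _ _ _ A1 Amax A0 A0 e.
by move/(congr1 val); rewrite /= modn_small //; lia.
Qed.

(** * Singer's difference set *)

(** [None] stands for the point at infinity of the projective line over K. *)
Definition linpoly (K : nzRingType) (o : option K) : {poly K} :=
  if o is Some a then 'X - a%:P else 1.

Section LinPoly.
Variable K : fieldType.
Implicit Types u v : option K.

Lemma linpoly_monic u : linpoly u \is monic.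
Proof. by case: u => [a|] /=; rewrite ?monicXsubC ?monic1. Qed.

Lemma size_linpoly u : (size (linpoly u) <= 2)%N.
Proof. by case: u => [a|] /=; rewrite ?size_XsubC ?size_poly1. Qed.

Lemma linpoly_inj : injective (@linpoly K).
Proof.
have neq1 a : 'X - a%:P != 1 :> {poly K}.
  by apply/eqP => /(congr1 (fun P : {poly K} => size P));
     rewrite size_XsubC size_poly1.
case=> [a|] [b|] //= e; last 2 first.
- by have /eqP := neq1 a.
- by have /eqP := neq1 b; case.
by have := root_XsubC b b; rewrite -e root_XsubC eqxx => /eqP ->.
Qed.

(** Unique factorization: a root of the left-hand side identifies a factor of
    the right-hand side, which cancels. *)
Lemma linpolyM_inj u v u' v' :
    linpoly u * linpoly v = linpoly u' * linpoly v' ->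
  (u = u' /\ v = v') \/ (u = v' /\ v = u').
Proof.
have cancel (x y z : option K) :
    linpoly x * linpoly y = linpoly x * linpoly z -> y = z.
  by move/(mulfI (monic_neq0 (linpoly_monic x))) => /linpoly_inj.
have Some_case a (x y z : option K) :
    linpoly (Some a) * linpoly x = linpoly y * linpoly z ->
    (Some a = y /\ x = z) \/ (Some a = z /\ x = y).
  move=> e; have: root (linpoly y * linpoly z) a.
    by rewrite -e rootM root_XsubC eqxx.
  have rootE o : root (linpoly o) a -> o = Some a.
    case: o => [b|] /=; last by rewrite (negPf (root1 _)).
    by rewrite root_XsubC => /eqP ->.
  rewrite rootM => /orP[] /rootE o_a; rewrite o_a in e *.
    by left; split=> //; apply: cancel e.
  by right; split=> //; apply: (cancel (Some a)); rewrite e mulrC.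
case: u => [a|]; first exact: Some_case.
case: v => [b|]; first by rewrite mulrC => /Some_case[] [-> ->]; tauto.
case: u' => [a|]; first by move/esym/Some_case; intuition congruence.
by move/cancel => <-; left.
Qed.

End LinPoly.

Lemma prim_root_neq0 (F : fieldType) n (z : F) : n.-primitive_root z -> z != 0.
Proof.
move=> prim_z; apply: contra_eq_neq (prim_expr_order prim_z) => ->.
by rewrite expr0n gtn_eqF ?(prim_order_gt0 prim_z) // eq_sym oner_neq0.
Qed.

Section Singer.
Variables (K : finFieldType) (p k : nat).
Let q := (p ^ k)%N.
Let n := (q ^ 2 + q).+1.
Hypotheses (charKp : p \in [pchar K]) (k_gt0 : (0 < k)%N).
Hypothesis cardK : #|K| = (q ^ 3)%N.

Let q_gt1 : (1 < q)%N.
Proof.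
have p_gt1 := prime_gt1 (pcharf_prime charKp).
by rewrite -(exp1n k) ltn_exp2r.
Qed.

Let cardKE : (q ^ 3).-1 = (n * q.-1)%N.
Proof. by move: q_gt1; rewrite /n; case: (q) => // r _ /=; nia. Qed.

Lemma primitive_elt : exists w : K, (q ^ 3).-1.-primitive_root w.
Proof.
have N0 : (0 < (q ^ 3).-1)%N by rewrite cardKE muln_gt0; move: q_gt1; lia.
suff /hasP[w _ prim_w] : has (q ^ 3).-1.-primitive_root (enum [set~ (0 : K)]).
  by exists w.
have q3_gt0 : (0 < q ^ 3)%N by case: (q) (q_gt1) => // r _; rewrite expn_gt0.
apply: has_prim_root => //.
- apply/allP => x; rewrite mem_enum !inE => x0; apply/unity_rootP.
  apply: (mulfI x0); rewrite -exprS prednK //.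
  by rewrite -cardK expf_card mulr1.
- exact: enum_uniq.
by rewrite -cardE cardsC1 cardK.
Qed.

Let Fq : {set K} := [set x | x ^+ q == x].

Let FqP x : reflect (x ^+ q = x) (x \in Fq).
Proof. by rewrite inE; apply: eqP. Qed.

Let frobB (x y : K) : (x - y) ^+ q = x ^+ q - y ^+ q.
Proof.
have q_nat : [pchar K].-nat q.
  by rewrite (eq_pnat _ (pcharf_eq charKp)) pnatX pnat_id ?(pcharf_prime charKp).
by apply: (addIr (y ^+ q)); rewrite -exprDn_pchar // !subrK.
Qed.

Let Fq_unit x : x != 0 -> x ^+ q.-1 = 1 -> x \in Fq.
Proof.
move=> x0 e; apply/FqP.
by rewrite -[q in LHS](prednK (ltnW q_gt1)) exprS e mulr1.
Qed.

Variable w : K.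
Hypothesis prim_w : (q ^ 3).-1.-primitive_root w.

Let w_neq0 : w != 0.
Proof. exact: prim_root_neq0 prim_w. Qed.

(** The powers of w^n, whose exponents are the multiples of (q^3-1)/(q-1), are
    q - 1 distinct solutions of x^q = x. *)
Lemma card_Fq : (q <= #|Fq|)%N.
Proof.
pose f (i : 'I_q.-1) := w ^+ (n * i).
have f_inj : injective f.
  move=> i j /eqP; rewrite (eq_prim_root_expr prim_w) cardKE.
  rewrite !modn_small ?ltn_pmul2l // eqn_pmul2l // => /eqP.
  exact: val_inj.
have sub : 0 |: [set f i | i in 'I_q.-1] \subset Fq.
  apply/subsetP => x /setU1P[->|/imsetP[i _ ->]].
    by apply/FqP; rewrite expr0n; move: q_gt1; case: (q).
  apply: Fq_unit; first exact: expf_neq0.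
  by rewrite -exprM mulnAC -cardKE exprM (prim_expr_order prim_w) expr1n.
apply: leq_trans (subset_leq_card sub).
rewrite cardsU1 card_imset // card_ord.
have -> : 0 \notin [set f i | i in 'I_q.-1].
  by apply/imsetP => -[i _ /esym/eqP]; rewrite expf_eq0 (negPf w_neq0) andbF.
by move: q_gt1; lia.
Qed.

Let S : {set option K} := None |: [set Some a | a in Fq].

Let frob_linpoly o x : o \in S -> (linpoly o).[x] ^+ q = (linpoly o).[x ^+ q].
Proof.
case/setU1P => [->|/imsetP[a /FqP aq ->]] /=; first by rewrite !hornerC expr1n.
by rewrite !hornerXsubC frobB aq.
Qed.

(** The elements of [Fq] are fixed by the q-th power map, so the relation
    satisfied by w also holds at w^q and w^(q^2).  These are three distinct
    elements, as w has order q^3 - 1, and the relation has degree at most 2, so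
    it is an identity between polynomials. *)
Lemma linpolyM_eval_inj u v u' v' c :
    u \in S -> v \in S -> u' \in S -> v' \in S -> c \in Fq ->
    (linpoly u).[w] * (linpoly v).[w] = c * ((linpoly u').[w] * (linpoly v').[w]) ->
  (u = u' /\ v = v') \/ (u = v' /\ v = u').
Proof.
move=> uS vS u'S v'S /FqP cq e0; apply: linpolyM_inj.
have frob x : (linpoly u).[x] * (linpoly v).[x]
        = c * ((linpoly u').[x] * (linpoly v').[x]) ->
    (linpoly u).[x ^+ q] * (linpoly v).[x ^+ q]
        = c * ((linpoly u').[x ^+ q] * (linpoly v').[x ^+ q]).
  by move/(congr1 (fun y => y ^+ q)); rewrite !exprMn !frob_linpoly ?cq.
have e1 := frob _ e0; have e2 := frob _ e1; rewrite -exprM in e2.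
pose P := linpoly u * linpoly v - c *: (linpoly u' * linpoly v').
have szM (x y : option K) : (size (linpoly x * linpoly y)%R <= 3)%N.
  apply: leq_trans (size_polyMleq _ _) _.
  by rewrite -subn1 leq_subLR; apply: (leq_add (size_linpoly x) (size_linpoly y)).
have szP : (size P <= 3)%N.
  apply: leq_trans (size_polyD _ _) _; rewrite size_polyN geq_max szM /=.
  exact: leq_trans (size_scale_leq _ _) (szM _ _).
have PE x : P.[x] = (linpoly u).[x] * (linpoly v).[x]
    - c * ((linpoly u').[x] * (linpoly v').[x]).
  by rewrite hornerD hornerN hornerZ !hornerM.
have P0 : P = 0.
  apply: (@roots_geq_poly_eq0 _ _ [:: w; w ^+ q; w ^+ (q * q)]) => //.
    by rewrite /= !rootE !PE e0 e1 e2 !subrr eqxx.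
  have neq i j : (i < j)%N -> (j <= q * q)%N -> w ^+ i != w ^+ j.
    move=> ij jq; rewrite (eq_prim_root_expr prim_w) !modn_small.
    - by rewrite neq_ltn ij.
    - by rewrite cardKE /n; move: q_gt1 jq; nia.
    - by rewrite cardKE /n; move: q_gt1 jq ij; nia.
  have := q_gt1 => q1.
  have n01 := @neq 1%N q q1; have n02 := @neq 1%N (q * q)%N.
  have n12 := @neq q (q * q)%N.
  rewrite expr1 in n01 n02.
  by rewrite /= !inE negb_or n01 ?n02 ?n12 //; nia.
have e : linpoly u * linpoly v = c *: (linpoly u' * linpoly v').
  by apply/eqP; rewrite -subr_eq0 -/P P0.
have mM (x y : option K) : linpoly x * linpoly y \is @monic K.
  by rewrite monicMl linpoly_monic.
have c1 : c = 1.
  have := congr1 (fun Q : {poly K} => lead_coef Q) e.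
  by rewrite /= lead_coefZ !(monicP (mM _ _)) mulr1.
by rewrite e c1 scale1r.
Qed.

(** Sums of logarithms mod n agree iff the products agree up to an element of
    [Fq], because w^(q-1) has order n. *)
Lemma singer_set : exists2 D : {set 'I_n}, (q < #|D|)%N & sidon D.
Proof.
have /fin_all_exists[L logL] : forall x : K, exists i : nat, x != 0 -> x = w ^+ i.
  move=> x; have [->|x0] := eqVneq x 0; first by exists 0%N.
  suff /(prim_rootP prim_w)[i ->] : x ^+ (q ^ 3).-1 = 1 by exists i.
  apply: (mulfI x0); rewrite -exprS prednK; last by rewrite expn_gt0 (ltnW q_gt1).
  by rewrite -cardK expf_card mulr1.
have lin0 o : o \in S -> (linpoly o).[w] != 0.
  case/setU1P => [->|/imsetP[a]]; first by rewrite hornerC oner_eq0.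
  rewrite inE => /eqP aq -> /=; rewrite hornerXsubC subr_eq0.
  apply/eqP => wa; move/eqP: aq.
  rewrite -wa -{2}[w]expr1 (eq_prim_root_expr prim_w) cardKE.
  by rewrite !modn_small /n; move: q_gt1; nia.
pose l o : 'I_n := inZp (L (linpoly o).[w]).
have sid u v u' v' : u \in S -> v \in S -> u' \in S -> v' \in S ->
    l u + l v = l u' + l v' -> (u = u' /\ v = v') \/ (u = v' /\ v = u').
  move=> uS vS u'S v'S /(congr1 val); rewrite /= !modnDm.
  set i := L _; set j := L _; set i' := L _; set j' := L _ => e.
  apply: (linpolyM_eval_inj (c := w ^+ (i + j) / w ^+ (i' + j'))) => //.
    rewrite inE; set c := w ^+ _ / _.
    suff c1 : c ^+ q.-1 = 1.
      by rewrite -[X in c ^+ X](prednK (ltnW q_gt1)) exprS c1 mulr1.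
    rewrite expr_div_n -!exprM ![(_ * q.-1)%N]mulnC !exprM.
    have wn : (w ^+ q.-1) ^+ n = 1.
      by rewrite -exprM mulnC -cardKE (prim_expr_order prim_w).
    by rewrite -(expr_mod _ wn) e expr_mod // divff // !expf_neq0.
  rewrite (logL _ (lin0 u uS)) (logL _ (lin0 v vS)).
  rewrite (logL _ (lin0 u' u'S)) (logL _ (lin0 v' v'S)).
  by rewrite -!exprD -/i -/j -/i' -/j' divfK // expf_neq0.
have NS : None \in S by rewrite setU11.
exists (l @: S).
  rewrite card_in_imset => [|u v uS vS luv].
    rewrite cardsU1 card_imset; last by move=> a b [].
    have -> : None \notin [set Some a | a in Fq] by apply/imsetP => -[].
    exact: card_Fq.
  have /sid[]// := congr1 (+%R^~ (l None)) luv; first by case.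
  by case=> -> ->.
move=> _ _ _ _ /imsetP[u uS ->] /imsetP[v vS ->] /imsetP[u' u'S ->] /imsetP[v' v'S ->].
by move/sid => [] // [-> ->]; [left | right].
Qed.

End Singer.

Theorem singer (p k : nat) (q := (p ^ k)%N) : prime p -> (0 < k)%N ->
  exists2 D : {set 'I_(q ^ 2 + q).+1}, (q < #|D|)%N & sidon D.
Proof.
move=> p_pr k_gt0.
have [|K charK] := @pPrimePowerField p (k * 3) p_pr.
  by rewrite muln_gt0 k_gt0.
rewrite expnM -/q => cardK.
have [w prim_w] := primitive_elt charK k_gt0 cardK.
exact: singer_set prim_w.
Qed.

Local Open Scope nat_scope.

(** * Edge sets of cycles *)

Section CycleEdges.
Variable V : finType.
Implicit Types (c : seq V) (E : {set {set V}}).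

Lemma cycle_edges_rot i c : uniq c -> cycle_edges (rot i c) = cycle_edges c.
Proof.
move=> Uc; apply/setP => e; apply/imsetP/imsetP => -[x xc ->]; exists x.
- by rewrite -(mem_rot i).
- by rewrite next_rot.
- by rewrite mem_rot.
- by rewrite next_rot.
Qed.

Lemma cycle_edges_rev c : uniq c -> cycle_edges (rev c) = cycle_edges c.
Proof.
move=> Uc; apply/setP => e; apply/imsetP/imsetP => -[x xc ->].
  exists (prev c x); first by rewrite mem_prev -mem_rev.
  by rewrite next_prev // next_rev // setUC.
exists (next c x); first by rewrite mem_rev mem_next.
by rewrite next_rev // prev_next // setUC.
Qed.

Lemma cycle_edges_sub c E : uniq c ->
  cycle_edges c \subset E -> cycle (fun x y => [set x; y] \in E) c.
Proof.
move=> Uc /subsetP sub; apply: cycle_from_next => // x xc.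
by apply: sub; apply/imsetP; exists x.
Qed.

Lemma sub_cycle_edges c E :
  cycle (fun x y => [set x; y] \in E) c -> cycle_edges c \subset E.
Proof.
by move=> cyc; apply/subsetP => _ /imsetP[x xc ->]; exact: (next_cycle cyc xc).
Qed.

Lemma set2_inj (x y x' y' : V) : [set x; y] = [set x'; y'] ->
  (x = x' /\ y = y') \/ (x = y' /\ y = x').
Proof.
move=> /setP e; have := e x; have := e y; have := e x'; have := e y'.
rewrite !inE !eqxx ?orbT => /orP hy' /orP hx' /esym/orP hy /esym/orP hx.
by case: hx hy hx' hy' => /eqP ? [] /eqP ? [] /eqP ? [] /eqP ?; subst; auto.
Qed.

End CycleEdges.

(** * The fan graph *)

Definition unit_step : rel nat := [rel a b | (b == a.+1) || (a == b.+1)].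

(** Without repetition the walk cannot turn back, so it is monotone. *)
Lemma unit_step_run x s : uniq (x :: s) -> path unit_step x s ->
  x :: s = iota x (size s).+1
  \/ size s <= x /\ rev (x :: s) = iota (x - size s) (size s).+1.
Proof.
elim: s x => [|y s IH] x; first by left.
rewrite cons_uniq => /andP[xNs Us] /=; rewrite -/(unit_step x y).
case/andP => xy /(IH _ Us) run.
case: run => [run|[le run]].
  case/orP: xy => /eqP def; first by left; rewrite run def.
  case: s {IH Us} run xNs => [|z s] run xNs.
    by right; rewrite /= def; split=> //; rewrite /rev /= subSS subn0.
  by move: xNs; rewrite run mem_iota /= def; lia.
case/orP: xy => /eqP def.
  move: xNs; rewrite -mem_rev run mem_iota.
  case: s {IH Us run} le => [|z s] /=; first by left; rewrite def.
  by rewrite def; lia.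
right; split; first by rewrite def.
rewrite [RHS](_ : _ = iota (x - (size s).+1) ((size s).+1 + 1)); last first.
  by rewrite addn1.
by rewrite rev_cons run -cats1 def iotaD subSS /= addnS subnK.
Qed.

Section Fan.
Variable m : nat.
Variable A : {set 'I_m.+1}.
Hypothesis A0 : ord0 \notin A.
Implicit Types x y : 'I_m.+1.

(** The edges of the fan, oriented from the smaller end to the larger one, so
    that an edge is given by exactly one pair. *)
Definition arrow : rel 'I_m.+1 :=
  [rel x y | if x == ord0 then y \in A else y == x.+1 :> nat].

Definition fan : {set {set 'I_m.+1}} :=
  [set [set u.1; u.2] | u in [set u | arrow u.1 u.2]].

Lemma arrow_lt x y : arrow x y -> x < y.
Proof.
rewrite /arrow /=; case: eqP => [-> yA|_ /eqP -> //].
by rewrite lt0n; apply: contraNneq A0 => y0; rewrite (_ : ord0 = y) //; apply: val_inj.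
Qed.

Lemma fanE x y : ([set x; y] \in fan) = arrow x y || arrow y x.
Proof.
apply/imsetP/orP => [[[a b]]|[xy|yx]].
- by rewrite inE => ab /set2_inj[][-> ->]; [left|right].
- by exists (x, y); rewrite ?inE.
by exists (y, x); rewrite ?inE //= setUC.
Qed.

Lemma fan_simple : simple_graph fan.
Proof.
apply/forall_inP => e /imsetP[[x y]]; rewrite inE => /arrow_lt /= xy e_def.
by rewrite e_def cards2 -val_eqE neq_ltn xy.
Qed.

Lemma card_fan : #|A| + m.-1 <= #|fan|.
Proof.
rewrite card_in_imset => [|[a b] [c d]]; last first.
  rewrite !inE /= => /arrow_lt ab /arrow_lt cd /set2_inj[][e1 e2].
    by rewrite e1 e2.
  by move: ab cd; rewrite e1 e2 => h1 /(ltn_trans h1); rewrite ltnn.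
pose spokes : {set 'I_m.+1 * 'I_m.+1} := [set (ord0, a) | a in A].
pose rim :=
  [set (i, inord i.+1 : 'I_m.+1) | i : 'I_m.+1 in ~: [set ord0; ord_max]].
have cs : #|spokes| = #|A| by rewrite card_imset // => a b [].
have cr : m.-1 <= #|rim|.
  rewrite card_imset; last by move=> a b [].
  have := cardsC [set (ord0 : 'I_m.+1); ord_max].
  by rewrite cards2 card_ord; case: (_ != _); lia.
have dis : spokes :&: rim = set0.
  apply/setP => u; rewrite !inE; apply/andP => -[/imsetP[a aA ->] /imsetP[i]].
  by rewrite !inE negb_or => /andP[i0 _] [/esym/eqP]; rewrite (negPf i0).
apply: leq_trans (subset_leq_card (_ : spokes :|: rim \subset _)).
  by rewrite cardsU dis cards0 cs subn0 leq_add2l.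
apply/subsetP => u /setUP[] /imsetP[x xA ->]; rewrite inE /arrow /=.
  exact: xA.
move: xA; rewrite !inE negb_or => /andP[/negPf -> xm].
by rewrite inordK // ltnS ltn_neqAle leq_ord andbT.
Qed.

Lemma arrow_step x y : x != ord0 -> y != ord0 -> arrow x y || arrow y x ->
  unit_step x y.
Proof. by rewrite /arrow /unit_step /= => /negPf -> /negPf ->. Qed.

Lemma fan_path x s : ord0 \notin x :: s ->
  path (fun x y => [set x; y] \in fan) x s ->
  path unit_step x (map (@nat_of_ord m.+1) s).
Proof.
elim: s x => //= y s IH x; rewrite !inE !negb_or => /and3P[x0 y0 s0].
rewrite fanE => /andP[xy /IH->]; last by rewrite inE negb_or y0.
by rewrite andbT; apply: arrow_step; rewrite // eq_sym.
Qed.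

(** Away from the hub a cycle would be a monotone walk on at least three
    consecutive integers, whose ends are too far apart to be adjacent. *)
Lemma fan_cycle_hub c : uniq c -> 2 < size c -> cycle_edges c \subset fan ->
  ord0 \in c.
Proof.
move=> Uc sz /(cycle_edges_sub Uc); apply: contraTT => c0.
case: c Uc sz c0 => // x s Uc sz c0; apply/negP => /=.
rewrite rcons_path => /andP[/(fan_path c0) pxs].
have l0 : last x s != ord0 by apply: contraNneq c0 => <-; apply: mem_last.
have x0 : x != ord0 by apply: contraNneq c0 => ->; rewrite mem_head.
rewrite fanE => /(arrow_step l0 x0).
have Uv : uniq ((x : nat) :: map (@nat_of_ord m.+1) s).
  by rewrite -map_cons map_inj_uniq //; apply: ord_inj.
have ln : last x s = last (x : nat) (map (@nat_of_ord m.+1) s) :> nat.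
  by rewrite last_map.
move: sz; rewrite /unit_step /= ln.
rewrite (last_nth 0); have [->|[le run]] := unit_step_run Uv pxs.
  by rewrite size_map nth_iota //; lia.
rewrite size_map in le run *.
rewrite -[_ :: _]revK run nth_rev size_iota // subnn nth_iota //.
by lia.
Qed.

(** Past the hub, a cycle is a monotone walk between two vertices of A.  Up to
    rotation and reversal it is thus determined by x and its length; as the
    length fixes the difference y - x, it also fixes x if A is a Sidon set. *)
Lemma fan_cycle_run c : uniq c -> 2 < size c -> cycle_edges c \subset fan ->
  exists c' x y, [/\ map (@nat_of_ord m.+1) c' = 0 :: iota x (size c).-1,
    cycle_edges c' = cycle_edges c, x \in A, y \in A & y = x + (size c).-2 :> nat].
Proof.
move=> Uc sz sub; case/rot_to: (fan_cycle_hub Uc sz sub) => i s def_s.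
have Uc1 : uniq (ord0 :: s) by rewrite -def_s rot_uniq.
have Ec1 : cycle_edges (ord0 :: s) = cycle_edges c.
  by rewrite -def_s cycle_edges_rot.
have szs : size s = (size c).-1 by rewrite -(size_rot i c) def_s.
(* A descending walk is replaced by its reversal, which has the same edges. *)
have [c1 [a [c1E Uc2 Ec2]]] : exists c1 a,
    [/\ map (@nat_of_ord m.+1) c1 = iota a (size s),
    uniq (ord0 :: c1) & cycle_edges (ord0 :: c1) = cycle_edges c].
  have := sub; rewrite -Ec1 => /(cycle_edges_sub Uc1).
  case: s {def_s} szs Uc1 Ec1 => [|y s] szs Uc1 Ec1.
    by move: sz szs => /=; lia.
  rewrite /= rcons_path => /and3P[_ p _].
  case/andP: (Uc1) => s0 Us.
  have {}p := fan_path s0 p.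
  have Uv : uniq ((y : nat) :: map (@nat_of_ord m.+1) s).
    by rewrite -map_cons map_inj_uniq //; apply: ord_inj.
  have [run|[le run]] := unit_step_run Uv p; rewrite size_map in run.
    by exists (y :: s), (y : nat).
  exists (rev (y :: s)), ((y : nat) - size s); split.
  - by rewrite map_rev.
  - by rewrite mem_rev rev_uniq.
  have Urev : uniq (ord0 :: rev (y :: s)) by rewrite cons_uniq mem_rev rev_uniq.
  by rewrite -(cycle_edges_rot 1 Urev) rot1_cons -rev_cons cycle_edges_rev.
have := sub; rewrite -Ec2 => /(cycle_edges_sub Uc2).
have sz1 : size c1 = size s by rewrite -(size_map (@nat_of_ord m.+1)) c1E size_iota.
have spoke x : x \in c1 -> [set ord0; x] \in fan -> x \in A.
  move=> xc; rewrite fanE {1}/arrow /= => /orP[//|/arrow_lt].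
  by rewrite ltn0.
case: c1 c1E sz1 Uc2 Ec2 spoke => [|x c1] /= c1E sz1 Uc2 Ec2 spoke.
  by have := sz; rewrite -(ltn_predK sz) -szs -sz1.
rewrite rcons_path => /and3P[sx _ sy].
exists [:: ord0, x & c1], x, (last x c1); split=> //=.
- by move: c1E; rewrite -szs -sz1 /= => -[<-] <-.
- by apply: spoke => //; apply: mem_head.
- by apply: spoke; [apply: mem_last | rewrite setUC].
have -> : (size c).-2 = size c1 by rewrite -szs -sz1.
rewrite -(last_map (@nat_of_ord m.+1)) (last_nth 0) size_map.
by move: c1E; rewrite -sz1 /= => -[<- ->]; rewrite (nth_iota 0 x (ltnSn _)).
Qed.

Lemma fan_no_repeated_cycle_length : sidon A -> no_repeated_cycle_length fan.
Proof.
move=> sidA; apply/no_repeated_cycle_lengthP => k C1 C2.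
case/and3P=> k3 sub1 /existsP[c1 /andP[Uc1 /eqP defC1]].
case/and3P=> _ sub2 /existsP[c2 /andP[Uc2 /eqP defC2]]; subst C1 C2.
have sz1 : 2 < size c1 by rewrite size_tuple.
have sz2 : 2 < size c2 by rewrite size_tuple.
have [c1' [x1 [y1 [c1E <- x1A y1A d1]]]] := fan_cycle_run Uc1 sz1 sub1.
have [c2' [x2 [y2 [c2E <- x2A y2A d2]]]] := fan_cycle_run Uc2 sz2 sub2.
rewrite !size_tuple in c1E d1 c2E d2.
have diff (x y : 'I_m.+1) : y = x + k.-2 :> nat -> (y - x = inZp k.-2)%R.
  move=> e; apply: (addIr x); rewrite subrK; apply: val_inj.
  by rewrite /= modnDml addnC -e modn_small.
have y1x1 : y1 != x1 by rewrite -val_eqE /= d1; move: k3; lia.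
have dif12 : (y1 - x1 = y2 - x2)%R by rewrite (diff _ _ d1) (diff _ _ d2).
have [_ x12] := sidon_diff sidA y1A x1A y2A x2A dif12 y1x1.
congr cycle_edges; apply: (inj_map (@ord_inj m.+1)).
by rewrite c1E c2E x12.
Qed.

Lemma path_iota (e : rel nat) a n :
  (forall i, a <= i < a + n -> e i i.+1) -> path e a (iota a.+1 n).
Proof.
elim: n a => //= n IH a step; rewrite step ?IH; last by lia.
  by [].
by move=> i ?; apply: step; lia.
Qed.

Lemma fan_hamiltonian : 1 < m -> inZp 1 \in A -> ord_max \in A -> hamiltonian fan.
Proof.
move=> m1 A1 Am; pose c := [seq (inord i : 'I_m.+1) | i <- iota 0 m.+1].
have cE : map (@nat_of_ord m.+1) c = iota 0 m.+1.
  rewrite -map_comp -[RHS]map_id; apply/eq_in_map => i.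
  by rewrite mem_iota => /= im; rewrite inordK.
have Uc : uniq c by rewrite -(map_inj_uniq (@ord_inj m.+1)) cE iota_uniq.
have szc : size c == #|'I_m.+1| by rewrite size_map size_iota card_ord.
apply/existsP; exists (cycle_edges c); apply/and3P; split.
- by rewrite card_ord.
- apply: sub_cycle_edges; rewrite cycle_map /= rcons_path; apply/andP; split.
    apply: path_iota => i /andP[_ im]; rewrite /= fanE.
    have im1 : i.+1 < m.+1 by [].
    apply/orP; left; rewrite /arrow /= -val_eqE /= !inordK //; last exact: ltnW.
    case: i im im1 => [|i] im im1 //=; rewrite (_ : inord 1 = inZp 1) //.
    by apply: val_inj; rewrite /= inordK // modn_small.
  have -> : last 0 (iota 1 m) = m.
    by rewrite (last_nth 0) size_iota -[_ :: _]/(iota 0 m.+1) nth_iota.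
  rewrite /= fanE; apply/orP; right; rewrite /arrow /=.
  have -> : inord 0 = ord0 :> 'I_m.+1 by apply: ord_inj; rewrite inordK.
  by rewrite eqxx (_ : inord m = ord_max) //; apply: ord_inj; rewrite inordK.
by apply/existsP; exists (Tuple szc); rewrite Uc eqxx.
Qed.

End Fan.

Local Open Scope ring_scope.

Lemma g_lower_bound q (D : {set 'I_(q ^ 2 + q).+1}) :
    sidon D -> (q < #|D|)%N -> (1 < q)%N ->
  (q ^ 2 + q + q <= g (q ^ 2 + q).+1)%N.
Proof.
move=> sidD cD q1; set m := (q ^ 2 + q)%N.
have [A [sidA cA A0 A1 Am]] := sidon_normalize sidD cD erefl q1.
apply: leq_trans (_ : #|fan A| <= _)%N.
  have m_gt0 : (0 < m)%N by rewrite addn_gt0 (ltnW q1) orbT.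
  apply: leq_trans (card_fan A0).
  by rewrite -[X in (X + q)%N](prednK m_gt0) addSnnS addnC leq_add2r.
rewrite /g; apply: leq_bigmax_cond; apply/and3P; split.
- exact: fan_simple.
- by apply: fan_hamiltonian => //; rewrite /m; nia.
exact: fan_no_repeated_cycle_length.
Qed.

Theorem theorem1p1 (R : rcfType) (p k q n : nat) (p_prime : prime p)
    (k_gt0 : (0 < k)%N) (def_q : q = (p ^ k)%N)
    (def_n : n = (q ^ 2 + q + 1)%N) :
  ((g n)%:R : R) >= n%:R + Num.sqrt (n%:R - 3 / 4) - 3 / 2.
Proof.
have q_gt1 : (1 < q)%N by rewrite def_q -(exp1n k) ltn_exp2r // prime_gt1.
have [D cD sidD] : exists2 D : {set 'I_(q ^ 2 + q).+1}, (q < #|D|)%N & sidon D.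
  by rewrite def_q; apply: singer.
have -> : n%:R - 3 / 4 = (q%:R + 1 / 2) ^+ 2 :> R.
  by rewrite def_n !natrD natrX; field.
rewrite sqrtr_sqr ger0_norm; last by rewrite addr_ge0 ?ler0n // divr_ge0.
rewrite (_ : _ - _ = (q ^ 2 + q + q)%:R); last first.
  by rewrite def_n !natrD natrX; field.
by rewrite def_n addn1 ler_nat; apply: g_lower_bound sidD cD q_gt1.
Qed.
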